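(* For every permutation $\rho\in\mathcal{S}_k$ and every $n\ge 0$, $\mathrm{r}_n(\rho)=\mathrm{s}_n(\rho^{\leftrightarrow})$.
   Context: $\mathcal{S}_n$ is the set of permutations of $[n]$, $\pi^r$ the reversal of $\pi$. A word $w$ contains $\rho\in\mathcal{S}_k$ if some subsequence $w_{i_1}\cdots w_{i_k}$ ($i_1<\cdots<i_k$) satisfies $w_{i_a}\le w_{i_b}$ iff $\rho_a\le\rho_b$; otherwise it avoids $\rho$. $\mathcal{R}_n=\{\pi\pi^r:\pi\in\mathcal{S}_n\}$ (concatenation of $\pi$ with its reversal), and $\mathrm{r}_n(\rho)$ is the number of members of $\mathcal{R}_n$ avoiding $\rho$. For a set $B$ of permutations, $\mathrm{s}_n(B)$ is the number of $\pi\in\mathcal{S}_n$ avoiding every member of $B$. A shuffle of words $\alpha_1\cdots\alpha_i$ and $\beta_1\cdots\beta_j$ is a word of length $i+j$ whose positions can be split into two disjoint subsequences, one equal to $\alpha$ and the other equal to $\beta$. For $\rho\in\mathcal{S}_k$, $\rho^{\leftrightarrow}$ is the set of all permutations that are shuffles of $\rho_1\cdots\rho_i$ and $\rho_k\rho_{k-1}\cdots\rho_{i+1}$ for some $1\le i\le k$. *)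

(* Defs.v *)
From mathcomp Require Import all_boot all_fingroup.

Set Implicit Arguments.
Unset Strict Implicit.
Unset Printing Implicit Defensive.

(* [n] = {1, ..., n} is represented by 'I_n = {0, ..., n-1}
   and a word over [n] by a seq (or tuple) of 'I_n; letters are compared as
   natural numbers. *)

(* One-line notation pi_1 ... pi_n. *)
Definition oneline n (pi : 'S_n) : n.-tuple 'I_n := [tuple pi i | i < n].

(* f a is the position i_a of the a-th letter of the chosen subsequence. *)
Definition contains n k (w : seq 'I_n) (rho : 'S_k) : bool :=
  [exists f : {ffun 'I_k -> 'I_(size w)},
     [forall a : 'I_k, forall b : 'I_k, (a < b) ==> (f a < f b)] &&
     [forall a : 'I_k, forall b : 'I_k,
        (tnth (in_tuple w) (f a) <= tnth (in_tuple w) (f b))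
          == (rho a <= rho b)]].

Definition avoids n k (w : seq 'I_n) (rho : 'S_k) : bool := ~~ contains w rho.

Definition Rset n : {set (n + n).-tuple 'I_n} :=
  [set [tuple of oneline pi ++ rev (oneline pi)] | pi : 'S_n].

Definition r_num n k (rho : 'S_k) : nat := #|[set w in Rset n | avoids w rho]|.

Definition s_num n k (B : {set 'S_k}) : nat :=
  #|[set pi : 'S_n | [forall rho in B, avoids (oneline pi) rho]]|.

(* The mask m marks the positions of w that spell alpha; the unmarked
   positions spell beta. *)
Definition is_shuffle (T : eqType) (alpha beta w : seq T) : bool :=
  [exists m : (size w).-tuple bool,
     (mask m w == alpha) && (mask (map negb m) w == beta)].

Definition shuffles_lr k (rho : 'S_k) : {set 'S_k} :=
  [set sigma : 'S_k |
     [exists i : 'I_k.+1,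
        (1 <= i) &&
        is_shuffle (take i (oneline rho)) (rev (drop i (oneline rho)))
                   (oneline sigma)]].

(* Main.v *)
Require Import Defs.
From mathcomp Require Import all_boot all_fingroup.

(** In an occurrence [u = u1 ++ u2] of [rho] in [pi ++ rev pi], with [u1] in the
    left copy and [u2] in the right one, the letters of [u] are distinct, so the
    letters of [u1] and of [rev u2] occupy disjoint positions of [pi]; read along
    [pi] they form a shuffle of [u1] and [rev u2].  Conversely such a shuffle
    unfolds to an occurrence of [rho].  Hence [pi ++ rev pi] contains [rho] iff
    [pi] contains a member of [rho^<->].  An empty [u1] (excluded by [1 <= i])
    is avoided by moving the first letter of [u2] to the left copy. *)

(* [g] standardizes the occurrence [u] to [rho]. *)
Lemma containsP {n k} {w : seq 'I_n} {rho : 'S_k} (k_gt0 : 0 < k) :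
  reflect (exists u (g : 'I_n -> 'I_k),
             [/\ subseq u w, map g u = oneline rho
               & {in u &, forall x y, (g x <= g y) = (x <= y)}])
          (contains w rho).
Proof.
have ltT m : transitive (fun i j : 'I_m => i < j).
  by move=> ? ? ?; apply: ltn_trans.
have enumS m : sorted (fun i j : 'I_m => i < j) (enum 'I_m).
  by have := iota_ltn_sorted 0 m; rewrite -val_enum_ord sorted_map.
apply: (iffP existsP) => [[f /andP[/forallP fI /forallP fR]] | [u [g [uw gu gR]]]].
- pose h a := tnth (in_tuple w) (f a).
  have hR a b : (h a <= h b) = (rho a <= rho b).
    by have /forallP/(_ b)/eqP := fR a.
  have hI : injective h.
    move=> a b hab; apply: (@perm_inj _ rho); apply/val_inj/eqP.
    by rewrite eqn_leq -!hR hab leqnn.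
  (* [h] is injective, so [g] is [rho] composed with the inverse of [h]; letters outside the
     occurrence get the junk value 0, which exists in ['I_k] because [0 < k]. *)
  pose g x := if [pick a | h a == x] is Some a then rho a else Ordinal k_gt0.
  have gh a : g (h a) = rho a.
    rewrite /g; case: pickP => [b /eqP/hI -> //|/(_ a)].
    by rewrite eqxx.
  exists (map h (enum 'I_k)), g; split.
  + rewrite -[w in X in subseq _ X]/(tval (in_tuple w)) -[X in subseq _ X]map_tnth_enum.
    rewrite /h (map_comp (tnth _) f); apply: map_subseq.
    set s := map _ _.
    (* The chosen positions increase because [f] does, and a strictly increasing list is determined
       by its members. *)
    suff -> : s = filter [in s] (enum 'I_(size w)) by exact: filter_subseq.
    apply: (irr_sorted_eq (ltT _)) => [i||| i].
    * exact: ltnn.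
    * rewrite sorted_map; apply: sub_sorted (enumS k) => a b /= ab.
      by have /forallP/(_ b)/implyP/(_ ab) := fI a.
    * exact: (sorted_filter (ltT _) _ (enumS _)).
    * by rewrite mem_filter mem_enum andbT.
  + by rewrite -map_comp (eq_map gh).
  + by move=> _ _ /mapP[a _ ->] /mapP[b _ ->]; rewrite !gh hR.
- have /subseqP[m sm um] := uw.
  (* The positions spelling [u], in increasing order; they serve as the values of [f]. *)
  pose s := mask m (enum 'I_(size w)).
  have us : u = map (tnth (in_tuple w)) s.
    by rewrite /s map_mask map_tnth_enum.
  have sk : size s == k.
    by rewrite -(size_map (tnth (in_tuple w))) -us -(size_map g) gu size_tuple.
  pose t := Tuple sk.
  have sS : sorted (fun i j : 'I_(size w) => i < j) s.
    exact: (sorted_mask (ltT _) _ (enumS _)).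
  have gt a : g (tnth (in_tuple w) (tnth t a)) = rho a.
    have := congr1 (fun z => nth (rho a) z a) gu.
    have as_ : a < size s by rewrite (eqP sk).
    rewrite us -map_comp (nth_map (tnth t a)) // -tnth_nth tnth_mktuple => <-.
    by rewrite /=; congr (g (tnth _ _)); apply: tnth_nth.
  have ut a : tnth (in_tuple w) (tnth t a) \in u.
    by rewrite us map_f // mem_tnth.
  exists (finfun (tnth t)); apply/andP; split; apply/forallP=> a; apply/forallP=> b.
  + apply/implyP=> ab; rewrite !ffunE.
    have := sorted_ltn_nth (ltT _) (tnth t a) sS a b.
    by rewrite -!(tnth_nth _ t) !inE (eqP sk); apply.
  + by rewrite !ffunE -!gt gR.
Qed.

Lemma subseq_cat_split {T : eqType} {u s1 s2 : seq T} :
  subseq u (s1 ++ s2) ->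
  exists u1 u2, [/\ u = u1 ++ u2, subseq u1 s1 & subseq u2 s2].
Proof.
case/subseqP=> m; rewrite size_cat => sm ->.
exists (mask (take (size s1) m) s1), (mask (drop (size s1) m) s2).
have st : size (take (size s1) m) = size s1.
  by rewrite size_takel // sm leq_addr.
split; first by rewrite -mask_cat // cat_take_drop.
- by rewrite mask_subseq.
- by rewrite mask_subseq.
Qed.

Lemma subseq_cat_rev_split {T : eqType} {u s : seq T} :
  0 < size u -> subseq u (s ++ rev s) ->
  exists u1 u2, [/\ u = u1 ++ u2, 0 < size u1, subseq u1 s & subseq (rev u2) s].
Proof.
move=> u0 /subseq_cat_split[[|x u1] [u2 [Eu s1 s2]]].
- case: u2 Eu s2 => [|y u2] Eu s2; first by rewrite Eu in u0.
  exists [:: y], u2; split=> //.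
    by rewrite sub1seq -mem_rev (mem_subseq s2) // mem_head.
  by rewrite -subseq_rev revK (subseq_trans (subseq_cons _ _) s2).
- exists (x :: u1), u2; split=> //.
  by rewrite -subseq_rev revK.
Qed.

Lemma oneline_uniq {n} (pi : 'S_n) : uniq (oneline pi).
Proof. by rewrite map_inj_uniq ?enum_uniq //; exact: perm_inj. Qed.

Lemma oneline_inj {n} : injective (@oneline n).
Proof.
move=> p q pq; apply/permP=> i.
by have := congr1 (fun t => tnth t i) pq; rewrite !tnth_mktuple.
Qed.

Lemma oneline_of_uniq {n} (s : seq 'I_n) :
  uniq s -> size s = n -> exists sigma : 'S_n, oneline sigma = s :> seq 'I_n.
Proof.
move=> us /eqP sn; pose t := Tuple sn.
have tI : injective (tnth t) by apply/tuple_uniqP.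
exists (perm tI); rewrite -[RHS]/(tval t); congr tval.
by apply: eq_from_tnth => i; rewrite tnth_mktuple permE.
Qed.

(** The map [g] acts on letters, not on positions, so one [g] serves both occurrences: passing
    between [pi ++ rev pi] and [pi] only rearranges the letters of [u]. *)
Lemma contains_cat_rev {n k} (pi : 'S_n) (rho : 'S_k) (k_gt0 : 0 < k) :
  contains (oneline pi ++ rev (oneline pi)) rho
    = [exists sigma in shuffles_lr rho, contains (oneline pi) sigma].
Proof.
have pU := oneline_uniq pi; set p := tval (oneline pi) in pU *.
apply/(containsP k_gt0)/exists_inP.
- case=> u [g [up gu gR]].
  have uk : size u = k by rewrite -(size_map g) gu size_tuple.
  (* Every letter occurs twice in the doubled word, but [u] uses none twice, since its image under
     [g] is a permutation. *)
  have uU : uniq u by apply: (@map_uniq _ _ g); rewrite gu oneline_uniq.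
  have [|u1 [u2 [Eu u10 s1 s2]]] := subseq_cat_rev_split _ up; first by rewrite uk.
  (* The letters of [u] in the order in which [pi] lists them; [sigma] is the standardization of [v]
     by [g]. *)
  pose v := filter [in u] p.
  have upE : {subset u <= p}.
    by move=> x /(mem_subseq up); rewrite mem_cat mem_rev orbb.
  have uv : v =i u.
    by move=> x; rewrite mem_filter andb_idr //; apply: upE.
  have vU : uniq v by rewrite filter_uniq.
  have v_perm : perm_eq v u by apply: uniq_perm.
  have [sigma Es] : exists sigma : 'S_k, oneline sigma = map g v :> seq _.
    apply: oneline_of_uniq.
      by rewrite (perm_uniq (perm_map g v_perm)) gu oneline_uniq.
    by rewrite size_map (perm_size v_perm).
  exists sigma; last first.
    apply/(containsP k_gt0); exists v, g; split=> //; first exact: filter_subseq.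
    by move=> x y; rewrite !uv; apply: gR.
  have disj x : x \in u2 -> x \notin u1.
    move=> xu2; apply: contraL uU => xu1.
    rewrite Eu cat_uniq !negb_and negbK.
    by apply/orP; right; apply/orP; left; apply/hasP; exists x.
  (* As [pi] has distinct letters, any subsequence of it is the filter of [pi] by membership.
     Marking in [v] the letters of [u1] thus recovers [u1], and the unmarked ones form [rev u2]. *)
  have v1 : mask (map [in u1] v) v = u1.
    rewrite -filter_mask -filter_predI (subseq_uniqP pU s1).
    apply: eq_filter => x /=; rewrite mem_filter Eu mem_cat.
    by case: (boolP (x \in u1)) => //= /(mem_subseq s1) ->.
  have v2 : mask (map negb (map [in u1] v)) v = rev u2.
    rewrite -map_comp -filter_mask -filter_predI (subseq_uniqP pU s2).
    apply: eq_filter => x /=; rewrite Eu mem_cat mem_rev.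
    by case: (boolP (x \in u2)) => [/disj ->|_]; case: (x \in u1).
  have i_lt : size u1 < k.+1 by rewrite ltnS -uk Eu size_cat leq_addr.
  (* [rho] is cut after the image of [u1]; [u10] supplies [1 <= i]. *)
  rewrite inE; apply/existsP; exists (Ordinal i_lt); rewrite u10 /=.
  have sm : size (map [in u1] v) == size (oneline sigma) by rewrite Es !size_map.
  apply/existsP; exists (Tuple sm).
  rewrite [tval (Tuple _)]/= {1 2}Es -!map_mask v1 v2 -gu Eu map_cat.
  by rewrite -(size_map g u1) take_size_cat // drop_size_cat // map_rev !eqxx.
- case=> sigma; rewrite inE => /existsP[i /andP[_ /existsP[m /andP[/eqP m1 /eqP m2]]]].
  case/(containsP k_gt0)=> u [g [up gu gR]].
  (* The shuffle mask of [sigma] is applied to its occurrence [u]: marked letters are taken in the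
     left copy, the others backwards in the right copy. *)
  exists (mask m u ++ rev (mask (map negb m) u)), g; split.
  + apply: cat_subseq; first exact: subseq_trans (mask_subseq _ _) up.
    by rewrite subseq_rev; apply: subseq_trans (mask_subseq _ _) up.
  + by rewrite map_cat map_rev !map_mask gu m1 m2 revK cat_take_drop.
  + have sub x : x \in mask m u ++ rev (mask (map negb m) u) -> x \in u.
      by rewrite mem_cat mem_rev => /orP[]; apply: mem_mask.
    by move=> x y /sub xu /sub yu; apply: gR.
Qed.

Theorem theorem16 (k : nat) (rho : 'S_k) (n : nat) (k_gt0 : 0 < k) :
  r_num n rho = s_num n (shuffles_lr rho).
Proof.
pose F (pi : 'S_n) := [tuple of oneline pi ++ rev (oneline pi)].
(* The first [n] letters of [F pi] give back [pi], so counting words in [Rset n] amounts to counting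
   permutations. *)
have FI : injective F.
  move=> p q /(congr1 (fun t => take n (tval t))) /=.
  rewrite !take_size_cat ?size_tuple ?card_ord // => E.
  exact/oneline_inj/val_inj.
rewrite /r_num /s_num.
have -> : [set w in Rset n | avoids w rho] = F @: [set pi | avoids (F pi) rho].
  apply/setP=> w; rewrite inE; apply/andP/imsetP.
  - by case=> /imsetP[pi _ ->] a; exists pi; rewrite ?inE.
  - by case=> pi; rewrite inE => a ->; split=> //; apply/imsetP; exists pi.
rewrite card_imset //; apply: eq_card => pi; rewrite !inE.
by rewrite /avoids contains_cat_rev // negb_exists_in.
Qed.
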